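(* For every even integer $n\geq 6$, $\Pi^{bichrom}(n)\geq \left\lceil \frac{n-2}{36}\right\rceil+2$. That is, for every simple polygon $P$ and every set $S$ in general position in $P$ of $n/2$ red and $n/2$ blue points, there exist a red point $r$ and a blue point $b$ of $S$ such that every geodesic disk through $r$ and $b$ contains at least $\left\lceil \frac{n-2}{36}\right\rceil+2$ points of $S$.
   Context: $P$ is a simple polygon (a closed region). For $a,b\in P$, $g(a,b)$ denotes the shortest (geodesic) path from $a$ to $b$ inside $P$ and $|g(a,b)|$ its length. A geodesic disk with center $c$ and radius $r$ is $D(c,r)=\{x\in P:|g(c,x)|\le r\}$; it is ''through'' some points if those points lie on its boundary (distance exactly $r$ from $c$), and contains a point if the point belongs to it. General position of $S$: no three points of $S$ are geodesically collinear (one on the geodesic path between the other two), no four points among $S$ and the vertices of $P$ lie on the boundary of a common geodesic disk, there are no $x,y\in S$ and reflex vertex $p$ of $P$ with $y\in g(x,p)$, and no geodesic bisector of two points of $S$ passes through a vertex of $P$. $\Pi^{bichrom}(n)$ is the largest integer such that for every simple polygon $P$ and every such set $S$ of $n/2$ red and $n/2$ blue points, there exist a red point $r$ and a blue point $b$ such that every geodesic disk through them contains at least $\Pi^{bichrom}(n)$ points of $S$. *)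

(* Defs.v *)
From HB Require Import structures.
From mathcomp Require Import all_boot all_order all_algebra.
From mathcomp Require Import all_classical all_reals all_analysis.
Set Implicit Arguments. Unset Strict Implicit. Unset Printing Implicit Defensive.
Import Order.TTheory GRing.Theory Num.Theory.
Local Open Scope classical_set_scope.
Local Open Scope ring_scope.

Section Geo.
Variable R : realType.
Local Notation pt := (R^o * R^o)%type.

Definition edist (p q : pt) : R :=
  Num.sqrt ((p.1 - q.1) ^+ 2 + (p.2 - q.2) ^+ 2).

Definition seg (a b : pt) : set pt :=
  [set x | exists l : R, 0 <= l <= 1 /\
     x = ((1 - l) * a.1 + l * b.1, (1 - l) * a.2 + l * b.2)].

(* A polygon is given by its cyclic list of vertices v_0, ..., v_{k-1}. *)
Definition vtx (v : seq pt) (i : nat) : pt := nth (0, 0) v (i %% size v)%N.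

Definition pedge (v : seq pt) (i : nat) : set pt := seg (vtx v i) (vtx v i.+1).

Definition simple_polygon (v : seq pt) : Prop :=
  (3 <= size v)%N /\ uniq v /\
  forall i j, (i < size v)%N -> (j < size v)%N -> i <> j ->
    (if j == (i.+1 %% size v)%N then pedge v i `&` pedge v j = [set vtx v j]
     else if i == (j.+1 %% size v)%N then pedge v i `&` pedge v j = [set vtx v i]
     else pedge v i `&` pedge v j = set0).

Definition pboundary (v : seq pt) : set pt :=
  [set x | exists i, (i < size v)%N /\ pedge v i x].

Definition bnd_set (A : set pt) : Prop :=
  exists M : R, forall y, A y -> `|y.1| <= M /\ `|y.2| <= M.

(* points in the unbounded connected component of the complement of the boundary *)
Definition poutside (v : seq pt) : set pt :=
  [set x | exists A : set pt, A x /\ A `<=` ~` pboundary v /\ connected A /\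
                               ~ bnd_set A].

(* the polygon P as a closed region: boundary plus interior *)
Definition pregion (v : seq pt) : set pt := ~` poutside v.

Definition ppath (P : set pt) (g : R -> pt) (a b : pt) : Prop :=
  {within `[0, 1], continuous g} /\ g 0 = a /\ g 1 = b /\
  (forall t, 0 <= t <= 1 -> P (g t)).

Definition chain_lengths (g : R -> pt) : set R :=
  [set s | exists (n : nat) (t : nat -> R),
     0 <= t 0%N /\ t n <= 1 /\ (forall i, (i < n)%N -> t i <= t i.+1) /\
     s = \sum_(i < n) edist (g (t i)) (g (t i.+1))].

Definition rectifiable (g : R -> pt) : Prop := has_ubound (chain_lengths g).

Definition plength (g : R -> pt) : R := sup (chain_lengths g).

Definition gdist (P : set pt) (a b : pt) : R :=
  inf [set l | exists g, ppath P g a b /\ rectifiable g /\ l = plength g].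

Definition on_geodesic (P : set pt) (a b y : pt) : Prop :=
  exists g, ppath P g a b /\ rectifiable g /\ plength g = gdist P a b /\
    exists t, 0 <= t <= 1 /\ g t = y.

Definition cross (p q : pt) : R := p.1 * q.2 - p.2 * q.1.
Definition psub (p q : pt) : pt := (p.1 - q.1, p.2 - q.2).

(* twice the signed area; positive iff counterclockwise *)
Definition area2 (v : seq pt) : R := \sum_(i < size v) cross (vtx v i) (vtx v i.+1).

(* vertex i is reflex (interior angle > pi): it turns against the orientation *)
Definition reflex (v : seq pt) (i : nat) : Prop :=
  cross (psub (vtx v i) (vtx v (i + size v).-1)) (psub (vtx v i.+1) (vtx v i))
    * area2 v < 0.

Definition general_position (v : seq pt) (S : seq pt) : Prop :=
  let P := pregion v in
  (forall x y z, x \in S -> y \in S -> z \in S -> x != y -> y != z -> x != z ->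
     ~ on_geodesic P x z y) /\
  (forall p1 p2 p3 p4, p1 \in S ++ v -> p2 \in S ++ v -> p3 \in S ++ v ->
     p4 \in S ++ v -> uniq [:: p1; p2; p3; p4] ->
     ~ exists c rho, P c /\ gdist P c p1 = rho /\ gdist P c p2 = rho /\
                     gdist P c p3 = rho /\ gdist P c p4 = rho) /\
  (forall x y i, x \in S -> y \in S -> x != y -> (i < size v)%N -> reflex v i ->
     ~ on_geodesic P x (vtx v i) y) /\
  (forall x y i, x \in S -> y \in S -> x != y -> (i < size v)%N ->
     gdist P x (vtx v i) <> gdist P y (vtx v i)).

End Geo.
Notation plpt R := ((R : realType)^o * (R : realType)^o)%type.

(* Main.v *)
Require Import Defs.
From HB Require Import structures.
From mathcomp Require Import all_boot all_order all_algebra.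
From mathcomp Require Import all_classical all_reals all_analysis.
From mathcomp Require Import all_fingroup ring lra zify.
From Stdlib Require Import Btauto.
Set Implicit Arguments.
Unset Strict Implicit.
Unset Printing Implicit Defensive.
Import Order.TTheory GRing.Theory Num.Theory.
Import numFieldNormedType.Exports.
Local Open Scope classical_set_scope.
Local Open Scope ring_scope.

(* Suppose every pair of a red point [r] and a blue point [b] is on the boundary
   of a disk of centre [c] containing at most [k] further points.  Draw [r b] as
   a near-geodesic from [r] to [c] followed by one from [c] to [b].  If the edges
   of [(r1, b1)] and [(r2, b2)], with centres [c1] and [c2], meet at [x], then
   [x] is on, say, the [c1 r1] and [c2 r2] parts, and exchanging the tails at [x]
   gives [d(c1, r2) + d(c2, r1) <= d(c1, r1) + d(c2, r2)] (up to epsilon): one of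
   the two disks contains an endpoint of the other edge.  As K33 is not planar,
   among any three red and three blue points some edge thus has another of the
   six points in its disk.  For a random choice of the six points the expected
   number of such incidences is at most [9 * 2 * k / (n / 2 - 1)], which
   must be at least 1, so [k >= (n - 2) / 36]. *)

(** * Parity of crossings of polygonal chains *)

Section PlaneSegments.
Variable R : realFieldType.
Local Notation pt := (R * R)%type.
Implicit Types a b d e p q : pt.

Definition lexlt p q := (p.1 < q.1) || (p.1 == q.1) && (p.2 < q.2).

(** Twice the signed area of the triangle [a b d]: positive when [d] is to the left of the line from
    [a] to [b]. *)
Definition orient a b d : R :=
  (b.1 - a.1) * (d.2 - a.2) - (b.2 - a.2) * (d.1 - a.1).

Definition lerp a b (l : R) : pt :=
  ((1 - l) * a.1 + l * b.1, (1 - l) * a.2 + l * b.2).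

(** Segments are closed and may be degenerate: [meets a b d d] says that [d] lies on the segment
    [a b]. *)
Definition meets a b d e :=
  exists l m : R, [/\ 0 <= l <= 1, 0 <= m <= 1 & lerp a b l = lerp d e m].

Lemma meets_sym a b d e : meets a b d e -> meets d e a b.
Proof. by move=> [l [m [hl hm E]]]; exists m, l. Qed.

Lemma lerp0 a b : lerp a b 0 = a.
Proof. by rewrite /lerp [RHS]surjective_pairing; congr pair; ring. Qed.

Lemma lerp1 a b : lerp a b 1 = b.
Proof. by rewrite /lerp [RHS]surjective_pairing; congr pair; ring. Qed.

Lemma lerp_rev a b l : lerp a b (1 - l) = lerp b a l.
Proof. by rewrite /lerp; congr pair; ring. Qed.

Lemma meets_revl a b d e : meets b a d e -> meets a b d e.
Proof.
move=> [l [m [hl hm E]]]; exists (1 - l), m; split => //; last by rewrite lerp_rev.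
by lra.
Qed.

Lemma meets_revr a b d e : meets a b e d -> meets a b d e.
Proof. by move=> /meets_sym/meets_revl/meets_sym. Qed.

Lemma lexlt_total p q : p != q -> lexlt q p = ~~ lexlt p q.
Proof.
case: p q => [px py] [qx qy]; rewrite /lexlt /= xpair_eqE.
by case: (ltgtP px qx) => //= _; case: (ltgtP py qy).
Qed.

Lemma lexlt_trans : transitive lexlt.
Proof.
move=> q p s; rewrite /lexlt.
case: (ltgtP p.1 q.1) => //= [h _|h].
  by case: (ltgtP q.1 s.1) => //= [h' _|<-]; rewrite ?h // (lt_trans h h').
by rewrite h; case: (ltgtP q.1 s.1) => //= _; apply: lt_trans.
Qed.

Lemma lexlt_le p q : lexlt p q -> p.1 <= q.1.
Proof. by rewrite /lexlt; case: ltgtP. Qed.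

Lemma orient_rev a b d : orient b a d = - orient a b d.
Proof. by rewrite /orient; ring. Qed.

(** The affine function [orient d e] vanishes along [a b] at parameter [C / (C - D)], and
    [orient a b] along [d e] at [A / (A - B)]. The sign conditions put both in the unit interval;
    [A != B] excludes parallel lines. *)
Lemma meets_orient a b d e :
  orient a b d * orient a b e <= 0 -> orient d e a * orient d e b <= 0 ->
  orient a b d != orient a b e -> meets a b d e.
Proof.
set A := orient a b d; set B := orient a b e.
set C := orient d e a; set D := orient d e b => hAB hCD nAB.
have E : C - D = B - A by rewrite /A /B /C /D /orient; ring.
have nz : A - B != 0 by rewrite subr_eq0.
have nz' : C - D != 0 by rewrite E -oppr_eq0 opprB.
have unit_quot (x y : R) : x * y <= 0 -> x - y != 0 -> 0 <= x / (x - y) <= 1.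
  move=> xy; case: (ltgtP (x - y) 0) => // h _.
    by rewrite ler_ndivlMr // ler_ndivrMr // mul0r mul1r; nra.
  by rewrite ler_pdivlMr // ler_pdivrMr // mul0r mul1r; nra.
exists (C / (C - D)), (A / (A - B)); split; [exact: unit_quot|exact: unit_quot|].
move: nz nz'; rewrite /lerp /A /B /C /D /orient => nz nz'.
by congr pair; field; apply/andP.
Qed.

(** The order puts the point [d] of the line [a b] on the segment; its parameter is a quotient of
    abscissa differences, or of ordinate differences if the line is vertical. *)
Lemma meets_on a b d :
  lexlt a d -> lexlt d b -> orient a b d = 0 -> forall e, meets a b d e.
Proof.
move=> ad db o0 e.
have ab := lexlt_trans ad db.
suff [l hl E] : exists2 l : R, 0 <= l <= 1 & lerp a b l = d.
  exists l, 0; split => //; first by rewrite lexx ler01.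
  by rewrite E lerp0.
have [h|h] := ltP a.1 b.1.
  have h' : 0 < b.1 - a.1 by rewrite subr_gt0.
  set l := (d.1 - a.1) / (b.1 - a.1).
  have El : l * (b.1 - a.1) = d.1 - a.1 by rewrite divfK // gt_eqF.
  exists l.
    rewrite ler_pdivlMr // ler_pdivrMr // mul0r mul1r.
    by have := lexlt_le ad; have := lexlt_le db; lra.
  rewrite /lerp [RHS]surjective_pairing; congr pair; first by lra.
  apply: (mulIf (lt0r_neq0 h')).
  have -> : ((1 - l) * a.2 + l * b.2) * (b.1 - a.1) =
            a.2 * (b.1 - a.1) + l * (b.1 - a.1) * (b.2 - a.2) by ring.
  by rewrite El; move: o0; rewrite /orient; lra.
have := lexlt_le ad; have := lexlt_le db => h1 h2.
have e1 : d.1 = a.1 by lra.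
have e2 : b.1 = a.1 by lra.
move: ad db; rewrite /lexlt e1 e2 ltxx eqxx /= => ad db.
have h' : 0 < b.2 - a.2 by lra.
exists ((d.2 - a.2) / (b.2 - a.2)).
  by rewrite ler_pdivlMr // ler_pdivrMr // mul0r mul1r; lra.
rewrite /lerp [RHS]surjective_pairing e2 e1; congr pair; first by ring.
by field; rewrite gt_eqF.
Qed.


(* The identity behind these two lemmas: for an affine function [f],
   [f e * orient a b d - f d * orient a b e + f b * orient d e a
    - f a * orient d e b = 0]; it is used with [f] the abscissa minus that of
   one of the four points. *)
Lemma meets_interleaved a b d e :
  lexlt a d -> lexlt d b -> lexlt b e ->
  0 < orient a b d * orient d e b -> meets a b d e.
Proof.
move=> ad db be; set A := orient a b d; set D := orient d e b => AD.
have := lexlt_le ad; have := lexlt_le db; have := lexlt_le be => h1 h2 h3.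
(* Equal abscissas of [d] and [b] would give [A <= 0 <= D], contrary to [AD]. *)
have [db1|db1] := ltP d.1 b.1; last first.
  exfalso; have e1 : b.1 = d.1 by lra.
  have db2 : d.2 < b.2 by move: db; rewrite /lexlt e1 ltxx eqxx.
  have A0 : A = - ((b.1 - a.1) * (b.2 - d.2)) by rewrite /A /orient e1; ring.
  have D0 : D = (e.1 - b.1) * (b.2 - d.2) by rewrite /D /orient e1; ring.
  have p1 : 0 <= (b.1 - a.1) * (b.2 - d.2) by rewrite mulr_ge0 //; lra.
  have p2 : 0 <= (e.1 - b.1) * (b.2 - d.2) by rewrite mulr_ge0 //; lra.
  by move: AD; rewrite A0 D0 mulNr; have := mulr_ge0 p1 p2; lra.
set B := orient a b e; set C := orient d e a.
(* The identity with [f] vanishing at [b], and next with [f] vanishing at [d]. *)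
have EB : (b.1 - d.1) * B = - (e.1 - b.1) * A - (b.1 - a.1) * D.
  by rewrite /A /B /D /orient; ring.
have EC : (b.1 - d.1) * C = - (e.1 - d.1) * A - (d.1 - a.1) * D.
  by rewrite /A /C /D /orient; ring.
have p : 0 < b.1 - d.1 by lra.
have AA : 0 < A * A.
  rewrite -expr2 lt_def sqr_ge0 sqrf_eq0 andbT; apply/eqP=> A0.
  by move: AD; rewrite A0 mul0r ltxx.
have DD : 0 < D * D.
  rewrite -expr2 lt_def sqr_ge0 sqrf_eq0 andbT; apply/eqP=> D0.
  by move: AD; rewrite D0 mulr0 ltxx.
have AB : A * B <= 0.
  rewrite -(pmulr_rle0 _ p) mulrCA EB mulrBr !mulrA.
  have := mulr_ge0 (_ : 0 <= e.1 - b.1) (ltW AA).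
  have := mulr_ge0 (_ : 0 <= b.1 - a.1) (ltW AD).
  by move=> /(_ ltac:(lra)) ? /(_ ltac:(lra)) ?; lra.
have CD : C * D <= 0.
  rewrite -(pmulr_rle0 _ p) mulrA EC.
  have := mulr_ge0 (_ : 0 <= e.1 - d.1) (ltW AD).
  have := mulr_ge0 (_ : 0 <= d.1 - a.1) (ltW DD).
  by move=> /(_ ltac:(lra)) ? /(_ ltac:(lra)) ?; lra.
apply: meets_orient => //; apply/eqP; rewrite -/A -/B => e0.
by move: AB AA; rewrite -e0; lra.
Qed.

Lemma meets_nested a b d e :
  lexlt a d -> lexlt a e -> lexlt d b -> lexlt e b ->
  orient a b d * orient a b e < 0 -> meets a b d e.
Proof.
move=> ad ae db eb; set A := orient a b d; set B := orient a b e => AB.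
have := lexlt_le ad; have := lexlt_le db; have := lexlt_le eb.
have := lexlt_le ae => h1 h2 h3 h4.
set C := orient d e a; set D := orient d e b.
have [ab1|ab1] := ltP a.1 b.1; last first.
  have e1 : d.1 = a.1 by lra.
  have e2 : b.1 = a.1 by lra.
  by move: AB; rewrite /A /orient e1 e2 !subrr mul0r mulr0 subrr mul0r ltxx.
have EC : (b.1 - a.1) * C = (d.1 - a.1) * B - (e.1 - a.1) * A.
  by rewrite /A /B /C /orient; ring.
have ED : (b.1 - a.1) * D = (b.1 - e.1) * A - (b.1 - d.1) * B.
  by rewrite /A /B /D /orient; ring.
have p : 0 < b.1 - a.1 by lra.
apply: meets_orient; rewrite -/A -/B -/C -/D; first exact: ltW.
  rewrite -(pmulr_rle0 _ p) -(pmulr_rle0 _ p) mulrA mulrACA EC ED.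
  case: (ltgtP A 0) AB => [A0|A0|->]; last by rewrite mul0r ltxx.
    rewrite nmulr_rlt0 // => B0.
    have q1 : 0 <= (d.1 - a.1) * B by rewrite mulr_ge0 //; lra.
    have q2 : 0 <= (e.1 - a.1) * - A by rewrite mulr_ge0 //; lra.
    have q3 : 0 <= (b.1 - e.1) * - A by rewrite mulr_ge0 //; lra.
    have q4 : 0 <= (b.1 - d.1) * B by rewrite mulr_ge0 //; lra.
    by apply: mulr_ge0_le0; lra.
  rewrite pmulr_rlt0 // => B0.
  have q1 : 0 <= (d.1 - a.1) * - B by rewrite mulr_ge0 //; lra.
  have q2 : 0 <= (e.1 - a.1) * A by rewrite mulr_ge0 //; lra.
  have q3 : 0 <= (b.1 - e.1) * A by rewrite mulr_ge0 //; lra.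
  have q4 : 0 <= (b.1 - d.1) * - B by rewrite mulr_ge0 //; lra.
  by apply: mulr_le0_ge0; lra.
by apply/eqP=> e0; move: AB; rewrite e0; have := sqr_ge0 B; rewrite expr2; lra.
Qed.

(* [ray_below d a b]: the upward vertical ray from [d] crosses [ab];
   [ray_above d a b]: the downward one does.  Abscissas are compared
   lexicographically, i.e. after an infinitesimal shear, so that no general
   position is needed. *)
Definition ray_below d a b :=
  (lexlt a d (+) lexlt b d) &&
  (if lexlt a b then orient a b d < 0 else 0 < orient a b d).

Definition ray_above d a b :=
  (lexlt a d (+) lexlt b d) &&
  (if lexlt a b then 0 < orient a b d else orient a b d < 0).

Lemma ray_below_rev d a b : ray_below d b a = ray_below d a b.
Proof.
rewrite /ray_below; have [->//|/lexlt_total ->] := eqVneq a b.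
by rewrite addbC orient_rev; case: (lexlt a b); rewrite /= ?oppr_lt0 ?oppr_gt0.
Qed.

Lemma ray_above_rev d a b : ray_above d b a = ray_above d a b.
Proof.
rewrite /ray_above; have [->//|/lexlt_total ->] := eqVneq a b.
by rewrite addbC orient_rev; case: (lexlt a b); rewrite /= ?oppr_lt0 ?oppr_gt0.
Qed.

Lemma ray_below_deg d a : ray_below d a a = false.
Proof. by rewrite /ray_below addbb. Qed.

Lemma ray_above_deg d a : ray_above d a a = false.
Proof. by rewrite /ray_above addbb. Qed.

(** A point off the segment is strictly above or below it, so exactly one of its vertical rays
    crosses when it is between the ends, and none otherwise. *)
Lemma ray_addb d a b : ~ meets a b d d ->
  ray_below d a b (+) ray_above d a b = lexlt a d (+) lexlt b d.
Proof.
wlog ab : a b / lexlt a b => [IH nm|].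
  have [->|nab] := eqVneq a b; first by rewrite ray_below_deg ray_above_deg !addbb.
  have [lab|lab] := boolP (lexlt a b); first exact: IH.
  have lba : lexlt b a by rewrite lexlt_total.
  rewrite -(ray_below_rev d a b) -(ray_above_rev d a b) (IH _ _ lba) 1?addbC //.
  by move=> /meets_revl.
move=> nm; rewrite /ray_below /ray_above ab.
case: (boolP (lexlt a d)) => ad /=; last first.
  suff -> : lexlt b d = false by [].
  by apply/negP=> bd; case/negP: ad; apply: lexlt_trans ab bd.
case: (boolP (lexlt b d)) => //= bd.
case: (ltgtP (orient a b d) 0) => // o0.
case: nm; have [->|/lexlt_total db] := eqVneq b d.
  by exists 1, 1; rewrite !lexx ler01 !lerp1.
by apply: meets_on => //; rewrite db bd.
Qed.

(** Disjoint segments keep the same vertical order over the overlap of their projections. If [a b]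
    is the upper one, each of the two ends of the overlap is an end of [d e] below [a b] (counted on
    the left) or an end of [a b] above [d e] (counted on the right): two in all. If it is the lower
    one, nothing is counted. *)
Lemma seg_parity a b d e : ~ meets a b d e ->
  ray_below d a b (+) ray_below e a b =
  ray_above a d e (+) ray_above b d e.
Proof.
have [->|ab] := eqVneq a b; first by rewrite !ray_below_deg !addbb.
have [->|de] := eqVneq d e; first by rewrite !ray_above_deg !addbb.
wlog lab : a b ab / lexlt a b => [IH nm|].
  case: (boolP (lexlt a b)) => lab; first exact: IH.
  have lba : lexlt b a by rewrite lexlt_total.
  rewrite -!(ray_below_rev _ a b) (IH b a) 1?addbC 1?eq_sym //.
  by move=> /meets_revl.
wlog lde : d e de / lexlt d e => [IH nm|].
  case: (boolP (lexlt d e)) => lde; first exact: IH.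
  have led : lexlt e d by rewrite lexlt_total.
  rewrite -!(ray_above_rev _ d e) addbC (IH e d) 1?eq_sym //.
  by move=> /meets_revr.
move=> nm.
(* Distinct ends make [lexlt] total between the two segments. *)
have end_meets : [/\ a != d, a != e, b != d & b != e].
  split; apply/eqP=> E; apply: nm; rewrite E.
  - by exists 0, 0; rewrite !lexx ler01 !lerp0 ?lerp0.
  - by exists 0, 1; rewrite !lexx ler01 !lerp0 ?lerp1.
  - by exists 1, 0; rewrite !lexx ler01 !lerp1 ?lerp0.
  - by exists 1, 1; rewrite !lexx ler01 !lerp1 ?lerp1.
case: end_meets => nad nae nbd nbe.
have onA : lexlt a d -> lexlt d b -> orient a b d != 0.
  by move=> h h'; apply/eqP=> h0; apply: nm; apply: meets_on.
have onB : lexlt a e -> lexlt e b -> orient a b e != 0.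
  by move=> h h'; apply/eqP=> h0; apply: nm; apply: meets_revr; apply: meets_on.
have onC : lexlt d a -> lexlt a e -> orient d e a != 0.
  by move=> h h'; apply/eqP=> h0; apply: nm; apply: meets_sym; apply: meets_on.
have onD : lexlt d b -> lexlt b e -> orient d e b != 0.
  by move=> h h'; apply/eqP=> h0; apply: nm; apply/meets_sym/meets_revr/meets_on.
have opp_sign (x y : R) : x != 0 -> y != 0 -> ~ 0 < x * y -> (x < 0) = (0 < y).
  move=> x0 y0; case: (ltgtP x 0) x0 => // hx _; case: (ltgtP y 0) y0 => // hy _ [].
    by rewrite nmulr_rgt0.
  by rewrite pmulr_rgt0.
have same_sign (x y : R) : x != 0 -> y != 0 -> ~ x * y < 0 -> (x < 0) = (y < 0).
  move=> x0 y0; case: (ltgtP x 0) x0 => // hx _; case: (ltgtP y 0) y0 => // hy _ [].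
    by rewrite nmulr_rlt0.
  by rewrite pmulr_rlt0.
have same_pos (x y : R) : x != 0 -> y != 0 -> ~ x * y < 0 -> (0 < x) = (0 < y).
  move=> x0 y0 /(same_sign _ _ x0 y0).
  by case: (ltgtP x 0) x0 => // _ _; case: (ltgtP y 0) y0.
have T1 : lexlt b d -> lexlt a d by apply: lexlt_trans lab.
have T2 : lexlt a d -> lexlt a e by move=> h; apply: lexlt_trans h lde.
have T3 : lexlt b d -> lexlt b e by move=> h; apply: lexlt_trans h lde.
have T4 : lexlt b e -> lexlt a e by apply: lexlt_trans lab.
have M1 := @meets_interleaved a b d e.
have M2 := @meets_interleaved d e a b.
have M3 := @meets_nested a b d e.
have M4 := @meets_nested d e a b.
move: T1 T2 T3 T4 onA onB onC onD M1 M2 M3 M4.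
rewrite /ray_below /ray_above lab lde !(lexlt_total nad) !(lexlt_total nae).
rewrite !(lexlt_total nbd) !(lexlt_total nbe).
(* [T1] to [T4] exclude inconsistent orders, and separated projections give no crossing; two
   interleaved and two nested orders remain. *)
case: (lexlt a d); case: (lexlt a e); case: (lexlt b d); case: (lexlt b e);
  move=> //= T1 T2 T3 T4 A0 B0 C0 D0 M1 M2 M3 M4; rewrite ?addbF ?addFb //.
all: try solve [by have := T1 isT | by have := T2 isT
               | by have := T3 isT | by have := T4 isT].
- by apply: opp_sign; rewrite ?A0 ?D0 // => /(M1 isT isT isT).
- rewrite (same_sign _ _ (A0 isT isT) (B0 isT isT)) ?addbb //.
  by move=> /(M3 isT isT isT isT).
- rewrite (same_pos _ _ (C0 isT isT) (D0 isT isT)) ?addbb //.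
  by move=> /(M4 isT isT isT isT)/meets_sym.
- by apply: opp_sign; rewrite ?B0 ?C0 // mulrC => /(M2 isT isT isT)/meets_sym.
Qed.

Definition chain_below d (p : nat -> pt) N :=
  \big[addb/false]_(i < N) ray_below d (p i) (p i.+1).

Definition chain_above d (p : nat -> pt) N :=
  \big[addb/false]_(i < N) ray_above d (p i) (p i.+1).

Lemma seg_chain_parity a b (q : nat -> pt) M :
  (forall j, (j < M)%N -> ~ meets a b (q j) (q j.+1)) ->
  ray_below (q 0%N) a b (+) ray_below (q M) a b =
  chain_above a q M (+) chain_above b q M.
Proof.
elim: M => [|M IH] H; first by rewrite /chain_above !big_ord0 !addbb.
have {}IH := IH (fun j h => H j (ltnW h)).
have := seg_parity (H M (ltnSn M)).
rewrite /chain_above !big_ord_recr /= -!/(chain_above _ _ _); move: IH.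
move: (ray_below (q 0%N) a b) (ray_below (q M) a b) (ray_below (q M.+1) a b).
move: (chain_above a q M) (chain_above b q M) (ray_above a _ _) (ray_above b _ _).
by do 7!case.
Qed.

(** Adding [seg_parity] over all pairs of segments, the terms at inner vertices occur twice and
    cancel; only the ends of the chains are left. *)
Lemma chain_parity (p q : nat -> pt) N M :
  (forall i j, (i < N)%N -> (j < M)%N ->
     ~ meets (p i) (p i.+1) (q j) (q j.+1)) ->
  chain_below (q 0%N) p N (+) chain_below (q M) p N =
  chain_above (p 0%N) q M (+) chain_above (p N) q M.
Proof.
elim: N => [|N IH] H; first by rewrite /chain_below !big_ord0 !addbb.
have {}IH := IH (fun i j h => H i j (ltnW h)).
have := seg_chain_parity (fun j => H N j (ltnSn N)).
rewrite /chain_below !big_ord_recr /= -!/(chain_below _ _ _); move: IH.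
move: (ray_below (q 0%N) _ _) (ray_below (q M) _ _) (chain_above (p N.+1) q M).
move: (chain_below (q 0%N) p N) (chain_below (q M) p N).
move: (chain_above (p 0%N) q M) (chain_above (p N) q M).
by do 7!case.
Qed.

Lemma chain_addb d (p : nat -> pt) N :
  (forall i, (i < N)%N -> ~ meets (p i) (p i.+1) d d) ->
  chain_below d p N (+) chain_above d p N = lexlt (p 0%N) d (+) lexlt (p N) d.
Proof.
elim: N => [|N IH] H.
  by rewrite /chain_below /chain_above !big_ord0 !addbb.
have {}IH := IH (fun i h => H i (ltnW h)).
have := ray_addb (H N (ltnSn N)).
rewrite /chain_below /chain_above !big_ord_recr /=.
rewrite -/(chain_below _ _ _) -/(chain_above _ _ _); move: IH.
move: (chain_below d p N) (chain_above d p N) (lexlt (p N.+1) d).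
move: (lexlt (p 0%N) d) (lexlt (p N) d) (ray_below d _ _) (ray_above d _ _).
by do 7!case.
Qed.

Lemma meets_end a b d e : meets a b d d -> meets a b e d.
Proof.
move=> [l [m [hl hm E]]]; exists l, 1; split; rewrite ?lexx ?ler01 // lerp1 E.
by rewrite /lerp [RHS]surjective_pairing; congr pair; ring.
Qed.

(* Van Kampen's parity argument: sum [chain_parity] (the [X] below) over the 18
   pairs of independent edges.  Each term [chain_below v e] or [chain_above v e]
   comes up twice, or once of each kind, and the latter pairs add up to an odd
   number by [chain_addb] (the [Y] below). *)
Lemma K33_chains_meet (r b : nat -> pt) (c : nat -> nat -> nat -> pt) N :
  (0 < N)%N ->
  (forall i j, c i j 0%N = r i) -> (forall i j, c i j N = b j) ->
  b 0%N != b 1%N -> b 0%N != b 2%N -> b 1%N != b 2%N ->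
  ~ (forall i j k l, (i < 3)%N -> (j < 3)%N -> (k < 3)%N -> (l < 3)%N ->
       i != k -> j != l -> forall s t, (s < N)%N -> (t < N)%N ->
       ~ meets (c i j s) (c i j s.+1) (c k l t) (c k l t.+1)).
Proof.
move=> N0 c0 cN b01 b02 b12 H.
pose B v i j := chain_below v (c i j) N.
pose A v i j := chain_above v (c i j) N.
pose X i j k l := xorb (xorb (B (r k) i j) (B (b l) i j))
                       (xorb (A (r i) k l) (A (b j) k l)).
pose Y j l := xorb (xorb (B (b l) 1%N j) (A (b l) 1%N j))
                   (xorb (lexlt (r 1%N) (b l)) (lexlt (b j) (b l))).
have X0 i j k l : (i < 3)%N && (j < 3)%N && (k < 3)%N && (l < 3)%N ->
    (i != k) && (j != l) -> X i j k l = false.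
  move=> /andP[/andP[/andP[hi hj] hk] hl] /andP[hik hjl].
  have := chain_parity (H i j k l hi hj hk hl hik hjl).
  rewrite !c0 !cN /X /B /A.
  by do 4!case: (_ _ (c _ _) _).
have Y0 j l : (j < 3)%N && (l < 3)%N && (j != l) -> Y j l = false.
  move=> /andP[/andP[hj hl] jl].
  (* [b l] is the last vertex of the chain from [r 0], which is independent of the chain from [r 1]
     to [b j]; hence it is off the latter. *)
  have E : forall i, (i < N)%N -> ~ meets (c 1%N j i) (c 1%N j i.+1) (b l) (b l).
    have bl : b l = c 0%N l N.-1.+1 by rewrite prednK // cN.
    move=> i hi /(@meets_end _ _ _ (c 0%N l N.-1)); rewrite bl.
    by apply: (H 1%N j 0%N l) => //; rewrite prednK.
  have := chain_addb E; rewrite c0 cN /Y -/(B _ _ _) -/(A _ _ _).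
  by case: (B _ _ _); case: (A _ _ _); case: lexlt; case: lexlt.
(* The oddness comes from the three pairs of blue points: [lexlt] holds in exactly one direction for
   each. *)
have odd_sum : foldr xorb false
    ([:: X 0 0 1 1; X 0 0 1 2; X 0 0 2 1; X 0 0 2 2; X 0 1 1 0; X 0 1 1 2;
        X 0 1 2 0; X 0 1 2 2; X 0 2 1 0; X 0 2 1 1; X 0 2 2 0; X 0 2 2 1;
        X 1 0 2 1; X 1 0 2 2; X 1 1 2 0; X 1 1 2 2; X 1 2 2 0; X 1 2 2 1;
        Y 0 1; Y 0 2; Y 1 0; Y 1 2; Y 2 0; Y 2 1])%N = true.
  rewrite /X /Y /= (lexlt_total b01) (lexlt_total b02) (lexlt_total b12); clear.
  by btauto.
by clearbody X Y; move: odd_sum; rewrite !X0 // !Y0.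
Qed.

End PlaneSegments.

(** * Lengths of paths and geodesic distance *)

(** Follows from the Cauchy-Schwarz inequality [dot], itself due to the nonnegative square of
    [x * y' - x' * y]. *)
Lemma sqrt_sum_sq_triangle (R : realType) (x y x' y' : R) :
  Num.sqrt ((x + x') ^+ 2 + (y + y') ^+ 2) <=
  Num.sqrt (x ^+ 2 + y ^+ 2) + Num.sqrt (x' ^+ 2 + y' ^+ 2).
Proof.
set A := x ^+ 2 + y ^+ 2; set B := x' ^+ 2 + y' ^+ 2.
have A0 : 0 <= A by rewrite addr_ge0 ?sqr_ge0.
have B0 : 0 <= B by rewrite addr_ge0 ?sqr_ge0.
have dot : x * x' + y * y' <= Num.sqrt A * Num.sqrt B.
  rewrite -sqrtrM //; apply: le_trans (ler_norm _) _.
  rewrite -sqrtr_sqr ler_wsqrtr //.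
  have := sqr_ge0 (x * y' - x' * y); rewrite /A /B; lra.
have S0 : 0 <= Num.sqrt A + Num.sqrt B by rewrite addr_ge0 ?sqrtr_ge0.
rewrite -(ger0_norm S0) -sqrtr_sqr ler_wsqrtr //.
by rewrite [leRHS]sqrrD !sqr_sqrtr //; move: dot; rewrite /A /B; lra.
Qed.

Section Lengths.
Variable R : realType.
Local Notation pt := (plpt R).
Implicit Types (g : R -> pt) (p q s : pt).

Lemma edist_ge0 p q : 0 <= Defs.edist p q.
Proof. exact: sqrtr_ge0. Qed.

Lemma edistxx p : Defs.edist p p = 0.
Proof. by rewrite /Defs.edist !subrr expr0n /= addr0 sqrtr0. Qed.

Lemma edist_triangle q p s : Defs.edist p s <= Defs.edist p q + Defs.edist q s.
Proof.
have := sqrt_sum_sq_triangle (p.1 - q.1 : R) (p.2 - q.2 : R)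
                             (q.1 - s.1 : R) (q.2 - s.2 : R).
by apply: le_trans; rewrite /Defs.edist !addrA !subrK.
Qed.

Definition increasing_times n (t : nat -> R) (a b : R) :=
  [/\ a <= t 0, t n <= b & forall i, (i < n)%N -> t i <= t i.+1].

Definition chain_length g n (t : nat -> R) : R :=
  \sum_(i < n) Defs.edist (g (t i)) (g (t i.+1)).

(** Upper bounds on the length of a piece of path: they survive cutting, joining and
    reparametrization without handling suprema. *)
Definition length_le g a b (L : R) :=
  forall n t, increasing_times n t a b -> chain_length g n t <= L.

Lemma increasing_times_le n t a b i j : increasing_times n t a b ->
  (i <= j <= n)%N -> t i <= t j.
Proof.
move=> [_ _ H]; elim: j => [|j IH]; first by case: i.
case: (ltngtP i j.+1) => [ij jn| |->] //.
by apply: le_trans (IH _) (H j _) => //; lia.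
Qed.

Lemma increasing_times_mem n t a b i : increasing_times n t a b ->
  (i <= n)%N -> a <= t i <= b.
Proof.
move=> Ht le_in; have [h0 hn _] := Ht; apply/andP; split.
  by apply: le_trans h0 (increasing_times_le Ht _); rewrite le_in.
by apply: le_trans (increasing_times_le Ht _) hn; rewrite le_in leqnn.
Qed.

Lemma length_le_ge0 g a b L : a <= b -> length_le g a b L -> 0 <= L.
Proof.
move=> ab /(_ 0%N (fun=> a)); rewrite /chain_length big_ord0; apply.
by split.
Qed.

(* Cutting the times of a chain at [m] with [min] and [max] splits it into a
   chain before [m] and a chain after [m]. *)
Lemma length_le_cat g a m b L1 L2 : a <= m <= b ->
  length_le g a m L1 -> length_le g m b L2 -> length_le g a b (L1 + L2).
Proof.
move=> /andP[am mb] H1 H2 n t [h0 hn hi].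
have {}H1 := H1 n (fun i => Num.min (t i) m).
have {}H2 := H2 n (fun i => Num.max (t i) m).
apply: le_trans (lerD (H1 _) (H2 _)); first last.
- split; [by rewrite le_max lexx orbT|by rewrite ge_max hn|].
  by move=> i /hi h; rewrite ge_max !le_max h lexx orbT.
- split; [by rewrite le_min h0|by rewrite ge_min lexx orbT|].
  by move=> i /hi h; rewrite le_min !ge_min h lexx orbT.
rewrite -big_split /=; apply: ler_sum => i _; have := hi i (ltn_ord i) => h.
have [h1|h1] := leP (t i) m; have [h2|h2] := leP (t i.+1) m.
- by rewrite edistxx addr0.
- exact: edist_triangle.
- by have := lt_le_trans h1 (le_trans h h2); rewrite ltxx.
- by rewrite edistxx add0r.
Qed.

Lemma length_le_comp g h (f : R -> R) a b a' b' L :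
  (forall x y, a <= x -> x <= y -> y <= b -> f x <= f y) ->
  a' <= f a -> f b <= b' -> a <= b -> (forall x, a <= x <= b -> h x = g (f x)) ->
  length_le g a' b' L -> length_le h a b L.
Proof.
move=> fm fa fb ab E Hg n t Ht.
have mem i : (i <= n)%N -> a <= t i <= b := increasing_times_mem Ht.
have -> : chain_length h n t = chain_length g n (f \o t).
  by apply: eq_bigr => i _; rewrite /= !E ?mem // ltnW.
have [h0 hn hi] := Ht; apply: Hg; split.
- by apply: le_trans fa (fm _ _ _ _ _); case/andP: (mem 0%N isT).
- by apply: le_trans (fm _ _ _ _ _) fb; case/andP: (mem n (leqnn n)).
- move=> i le_in; case/andP: (mem i (ltnW le_in)) => ? _.
  by case/andP: (mem i.+1 le_in) => _ ?; apply: fm => //; apply: hi.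
Qed.

(** [L1] is the supremum of chain lengths before [m], and [L2 = L - L1]: a chain before [m] and one
    after it join into a chain of length at most [L]. *)
Lemma length_le_split g a m b L : a <= m <= b -> length_le g a b L ->
  exists L1 L2, [/\ L1 + L2 = L, length_le g a m L1 & length_le g m b L2].
Proof.
move=> /andP[am mb] H.
pose S1 := [set x | exists n t, increasing_times n t a m /\ x = chain_length g n t].
have cat x n t : S1 x -> increasing_times n t m b -> x + chain_length g n t <= L.
  move=> [n' [t' [Ht' ->]]] Ht.
  have [h0' hn' hi'] := Ht'; have [h0 hn hi] := Ht.
  (* The joined times have one additional step, from [t' n'] to [t 0], whose nonnegative length is
     dropped. *)
  pose u i := if (i <= n')%N then t' i else t (i - n'.+1)%N.
  have := H (n' + n.+1)%N u; rewrite /chain_length !big_split_ord /= big_ord_recl.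
  move=> Hu; apply: le_trans (Hu _).
    apply: lerD; first by apply: ler_sum => i _; rewrite /u /= ltn_ord ltnW.
    rewrite -[leLHS]add0r; apply: lerD; first exact: edist_ge0.
    apply: ler_sum => i _ /=; rewrite /u /bump /=.
    have -> : (n' + (1 + i) <= n')%N = false by lia.
    have -> : ((n' + (1 + i)).+1 <= n')%N = false by lia.
    have -> : (n' + (1 + i) - n'.+1 = i)%N by lia.
    by have -> : ((n' + (1 + i)).+1 - n'.+1 = i.+1)%N by lia.
  split; rewrite /u //.
    have -> : (n' + n.+1 <= n')%N = false by lia.
    by have -> : (n' + n.+1 - n'.+1 = n)%N by lia.
  move=> i hin; case: (ltngtP i n') => hi0.
  - by apply: hi'.
  - have -> : (i.+1 - n'.+1 = (i - n'.+1).+1)%N by lia.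
    by apply: hi; lia.
  - by rewrite hi0 subnn (le_trans hn').
have S10 : S1 0.
  by exists 0%N, (fun=> a); split; [split|rewrite /chain_length big_ord0].
have S1ub : has_ubound S1.
  exists L => x Sx; have := cat x 0%N (fun=> m) Sx.
  by rewrite /chain_length big_ord0 addr0; apply; split.
exists (sup S1), (L - sup S1); split; first by rewrite addrC subrK.
  by move=> n t Ht; apply: sup_ubound => //; exists n, t.
move=> n t Ht; rewrite lerBrDr addrC -lerBrDr; apply: ge_sup; first by exists 0.
by move=> x Sx; rewrite lerBrDr; apply: cat Sx Ht.
Qed.

Lemma chain_lengthsE g : chain_lengths g =
  [set x | exists n t, increasing_times n t 0 1 /\ x = chain_length g n t].
Proof.
apply/seteqP; split => x [n [t]].
  by move=> [h0 [hn [hi ->]]]; exists n, t.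
by move=> [[h0 hn hi] ->]; exists n, t.
Qed.

Lemma length_le_rectifiable g L : length_le g 0 1 L -> rectifiable g.
Proof.
by move=> H; exists L; rewrite chain_lengthsE => _ [n [t [Ht ->]]]; apply: H.
Qed.

Lemma chain_lengths_nonempty g : chain_lengths g !=set0.
Proof.
exists 0; rewrite chain_lengthsE; exists 0%N, (fun=> 0).
by rewrite /chain_length big_ord0; split => //; split => //; apply: ler01.
Qed.

Lemma plength_le g L : length_le g 0 1 L -> plength g <= L.
Proof.
move=> H; apply: ge_sup; first exact: chain_lengths_nonempty.
by rewrite chain_lengthsE => _ [n [t [Ht ->]]]; apply: H.
Qed.

Lemma length_le_plength g : rectifiable g -> length_le g 0 1 (plength g).
Proof.
by move=> rg n t Ht; apply: sup_ubound => //; rewrite chain_lengthsE; exists n, t.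
Qed.

Lemma plength_ge0 g : rectifiable g -> 0 <= plength g.
Proof. by move=> /length_le_plength; apply: length_le_ge0; apply: ler01. Qed.

Lemma gdist_le (P : set pt) g a b L :
  ppath P g a b -> length_le g 0 1 L -> gdist P a b <= L.
Proof.
move=> pg H; apply: le_trans (plength_le H); apply: inf_lbound.
  by exists 0 => _ [h [_ [rh ->]]]; apply: plength_ge0.
by exists g; split => //; split => //; apply: length_le_rectifiable H.
Qed.

(** Guarantees that [gdist] is the infimum of a nonempty set and not a default value. *)
Definition rconn (P : set pt) a b := exists g, ppath P g a b /\ rectifiable g.

(** Paths of length within [e] of the infimum replace shortest paths, so the infimum need not be
    attained. *)
Lemma near_geodesic (P : set pt) a b (e : R) : 0 < e -> rconn P a b ->
  exists2 g, ppath P g a b & length_le g 0 1 (gdist P a b + e).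
Proof.
move=> e0 [g [pg rg]].
have hi : has_inf [set l | exists h, ppath P h a b /\ rectifiable h /\ l = plength h].
  split; first by exists (plength g), g.
  by exists 0 => _ [h [_ [rh ->]]]; apply: plength_ge0.
have [_ [h [ph [rh ->]]] lt] := inf_adherent e0 hi.
exists h => // n t Ht; apply: le_trans (length_le_plength rh Ht) (ltW lt).
Qed.

End Lengths.

(** * Splicing paths and exchanging their tails *)

Section Paths.
Variable R : realType.
Local Notation pt := (plpt R).
Implicit Types (g : R -> pt) (P : set pt) (a b c : pt) (s t : R).

Lemma within01_continuousP g : {within `[0, 1], continuous g} <->
  forall x : R, 0 <= x <= 1 -> forall e : R, 0 < e -> exists2 d : R, 0 < d &
  forall y : R, 0 <= y <= 1 -> `|x - y| < d -> ball (g x) e (g y).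
Proof.
rewrite subspace_continuousP; split => H x x01.
  have {}x01 : `[0, 1]%classic x by rewrite /= in_itv.
  move=> e e0; have /cvg_ballP/(_ e e0) := H x x01.
  rewrite near_withinE => /nbhs_ballP[d /= d0 Hd]; exists d => // y y01 xy.
  by apply: Hd => //=; rewrite in_itv.
have {}x01 : 0 <= x <= 1 by move: x01; rewrite /= in_itv.
apply/cvg_ballP => e e0; rewrite near_withinE.
have [d d0 Hd] := H x x01 e e0.
apply/nbhs_ballP; exists d => // y xy; rewrite /= in_itv /= => y01; exact: Hd.
Qed.

(** Follows [g1] from time 0 to [s] on the first half of the unit interval, then [g2] from time [t]
    to 1 on the second. *)
Definition splice g1 (s : R) g2 (t : R) (u : R) : pt :=
  if u <= 2^-1 then g1 (2 * u * s) else g2 (t + (2 * u - 1) * (1 - t)).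

Lemma splice_ppath (P : set pt) g1 g2 a1 b1 a2 b2 s t :
  0 <= s <= 1 -> 0 <= t <= 1 -> ppath P g1 a1 b1 -> ppath P g2 a2 b2 ->
  g1 s = g2 t -> ppath P (splice g1 s g2 t) a1 b2.
Proof.
move=> s01 t01 [/within01_continuousP c1 [g10 [_ P1]]].
move=> [/within01_continuousP c2 [_ [g21 P2]]] E.
have mem1 u : 0 <= u <= 2^-1 -> 0 <= 2 * u * s <= 1.
  by move=> u01; apply/andP; split; nra.
have mem2 u : 2^-1 <= u <= 1 -> 0 <= t + (2 * u - 1) * (1 - t) <= 1.
  by move=> u01; apply/andP; split; nra.
have half : splice g1 s g2 t 2^-1 = g2 t.
  by rewrite /splice lexx divff ?mul1r // E.
have sR u : 2^-1 <= u -> splice g1 s g2 t u = g2 (t + (2 * u - 1) * (1 - t)).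
  rewrite le_eqVlt => /orP[/eqP <-|h]; last by rewrite /splice leNgt h.
  by rewrite half divff // subrr mul0r addr0.
split; last split; last split.
- apply/within01_continuousP => x x01 e e0.
  (* Both changes of time are 2-Lipschitz, whence the moduli [d / 2] below. *)
  have L (y z : R) : `|2 * y * s - 2 * z * s| <= 2 * `|y - z|.
    rewrite -mulrBl -mulrBr !normrM (ger0_norm (_ : 0 <= 2)) //.
    by rewrite ler_piMr ?mulr_ge0 // ler_norml; lra.
  have L' (y z : R) : `|(t + (2 * y - 1) * (1 - t)) -
                        (t + (2 * z - 1) * (1 - t))| <= 2 * `|y - z|.
    rewrite (_ : _ - _ = (1 - t) * (2 * (y - z))); last by ring.
    rewrite !normrM (ger0_norm (_ : 0 <= 2)) // ler_piMl ?mulr_ge0 //.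
    by rewrite ler_norml; lra.
  have [d1 d10 H1] : exists2 d, 0 < d & forall y, 0 <= y <= 2^-1 ->
      x <= 2^-1 -> `|x - y| < d ->
      ball (splice g1 s g2 t x) e (splice g1 s g2 t y).
    have [xh|xh] := leP x 2^-1; last first.
      by exists 1 => // y _; rewrite leNgt xh.
    have x0h : 0 <= x <= 2^-1 by rewrite xh andbT; case/andP: x01.
    have [d d0 Hd] := c1 _ (mem1 _ x0h) e e0.
    exists (d / 2); first by rewrite divr_gt0.
    move=> y y0h _ xy; have /andP[_ yh] := y0h; rewrite /splice xh yh.
    apply: Hd; first exact: mem1.
    by apply: le_lt_trans (L _ _) _ => //; rewrite mulrC -ltr_pdivlMr.
  have [d2 d20 H2] : exists2 d, 0 < d & forall y, 2^-1 <= y <= 1 ->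
      2^-1 <= x -> `|x - y| < d ->
      ball (splice g1 s g2 t x) e (splice g1 s g2 t y).
    have [xh|xh] := leP (2^-1) x; last first.
      by exists 1 => // y _.
    have xh1 : 2^-1 <= x <= 1 by rewrite xh; case/andP: x01.
    have [d d0 Hd] := c2 _ (mem2 _ xh1) e e0.
    exists (d / 2); first by rewrite divr_gt0.
    move=> y yh1 _ xy; have /andP[yh _] := yh1; rewrite !sR //.
    apply: Hd; first exact: mem2.
    by apply: le_lt_trans (L' _ _) _ => //; rewrite mulrC -ltr_pdivlMr.
  (* Off the midpoint the modulus is cut so as to stay on one half; at the midpoint both halves are
     controlled. *)
  have [xh|xh|xh] := ltgtP x 2^-1.
  + exists (Num.min d1 (2^-1 - x)); first by rewrite lt_min d10 subr_gt0.
    move=> y y01; rewrite lt_min => /andP[h1]; rewrite ltr_norml => h2.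
    by apply: H1 => //; lra.
  + exists (Num.min d2 (x - 2^-1)); first by rewrite lt_min d20 subr_gt0.
    move=> y y01; rewrite lt_min => /andP[h1]; rewrite ltr_norml => h2.
    by apply: H2 => //; lra.
  + exists (Num.min d1 d2); first by rewrite lt_min d10 d20.
    move=> y y01; rewrite lt_min => /andP[h1 h2]; have [yh|yh] := leP y 2^-1.
      by apply: H1 => //; rewrite ?yh ?xh ?lexx //; case/andP: y01 => ->.
    by apply: H2 => //; rewrite ?(ltW yh) ?xh ?lexx //; case/andP: y01.
- by rewrite /splice invr_ge0 ler0n mulr0 mul0r.
- by rewrite sR ?invf_le1 ?ler1n // -{}g21; congr g2; ring.
- move=> u u01; have [uh|uh] := leP u 2^-1.
    by rewrite /splice uh; apply: P1; apply: mem1; rewrite uh andbT; case/andP: u01.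
  by rewrite sR ?ltW //; apply: P2; apply: mem2; rewrite ltW //; case/andP: u01.
Qed.

Lemma splice_length g1 g2 s t L1 L2 :
  0 <= s <= 1 -> 0 <= t <= 1 -> g1 s = g2 t ->
  length_le g1 0 s L1 -> length_le g2 t 1 L2 ->
  length_le (splice g1 s g2 t) 0 1 (L1 + L2).
Proof.
move=> s01 t01 E H1 H2; apply: (@length_le_cat _ _ _ 2^-1); first by lra.
  apply: (length_le_comp (f := fun u => 2 * u * s)) H1.
  - by move=> x y ? ? ?; nra.
  - by rewrite mulr0 mul0r.
  - by rewrite divff // mul1r.
  - by lra.
  - by move=> x /andP[_ xh]; rewrite /splice xh.
apply: (length_le_comp (f := fun u => t + (2 * u - 1) * (1 - t))) H2.
- by move=> x y ? ? ?; nra.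
- by rewrite divff // subrr mul0r addr0.
- by lra.
- by lra.
- move=> x /andP[]; rewrite le_eqVlt => /orP[/eqP <- _|h _]; last first.
    by rewrite /splice leNgt h.
  by rewrite /splice lexx divff // subrr mul0r addr0 mul1r.
Qed.

Lemma rconn_trans P b a c : rconn P a b -> rconn P b c -> rconn P a c.
Proof.
move=> [g [pg rg]] [h [ph rh]].
have m0 : 0 <= (0 : R) <= 1 by rewrite lexx ler01.
have m1 : 0 <= (1 : R) <= 1 by rewrite lexx ler01.
have E : g 1 = h 0 by case: pg ph => _ [_ [-> _]] [_ [-> _]].
exists (splice g 1 h 0); split; first exact: splice_ppath pg ph E.
by apply/length_le_rectifiable/(splice_length m1 m0 E); apply: length_le_plength.
Qed.

(* Two crossing paths can exchange their second halves. *)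
Lemma gdist_exchange (P : set pt) g1 g2 a1 b1 a2 b2 s t L1 L2 :
  0 <= s <= 1 -> 0 <= t <= 1 -> ppath P g1 a1 b1 -> ppath P g2 a2 b2 ->
  length_le g1 0 1 L1 -> length_le g2 0 1 L2 -> g1 s = g2 t ->
  gdist P a1 b2 + gdist P a2 b1 <= L1 + L2.
Proof.
move=> s01 t01 p1 p2 l1 l2 E.
have [L11 [L12 [<- l11 l12]]] := length_le_split s01 l1.
have [L21 [L22 [<- l21 l22]]] := length_le_split t01 l2.
have E' := esym E.
have := gdist_le (splice_ppath s01 t01 p1 p2 E) (splice_length s01 t01 E l11 l22).
have := gdist_le (splice_ppath t01 s01 p2 p1 E') (splice_length t01 s01 E' l21 l12).
by lra.
Qed.

Lemma lerp_continuous a b : continuous (fun u : R => lerp a b u : pt).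
Proof.
have aff (y z : R) : continuous (fun x : R => (1 - x) * y + x * z).
  move=> x; apply: cvgD; apply: cvgM; try exact: cvg_cst; try exact: cvg_id.
  by apply: cvgB; [exact: cvg_cst|exact: cvg_id].
by move=> x; apply: cvg_pair (aff _ _ x) (aff _ _ x).
Qed.

(** The affine parametrization has constant speed, so chain lengths telescope. *)
Lemma rconn_seg P a b : seg a b `<=` P -> rconn P a b.
Proof.
move=> abP; pose g (u : R) : pt := lerp a b u.
exists g; split.
  split; last split; last split.
  - exact/continuous_subspaceT/lerp_continuous.
  - exact: lerp0.
  - exact: lerp1.
  - by move=> u u01; apply: abP; exists u.
have E u u' : u <= u' -> Defs.edist (g u) (g u') = (u' - u) * Defs.edist a b.
  move=> uu; rewrite /Defs.edist /g /lerp /=.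
  have diff (y z : R) :
      (1 - u) * y + u * z - ((1 - u') * y + u' * z) = (u' - u) * (y - z) by ring.
  by rewrite !diff !exprMn -mulrDr sqrtrM ?sqr_ge0 // sqrtr_sqr ger0_norm // subr_ge0.
apply: (@length_le_rectifiable _ _ (Defs.edist a b)) => n t [h0 hn hi].
have -> : chain_length g n t = (t n - t 0) * Defs.edist a b.
  rewrite /chain_length; elim: n {hn} hi => [|n IH] hi.
    by rewrite big_ord0 subrr mul0r.
  rewrite big_ord_recr /= IH => [|i hin]; last by apply: hi; rewrite ltnW.
  by rewrite E ?hi //; ring.
rewrite ler_piMl ?edist_ge0 //; lra.
Qed.

End Paths.

(** * Rectifiable connectedness of a polygonal region *)

Section Region.
Variable R : realType.
Local Notation pt := (plpt R).
Implicit Types (P : set pt) (a b c x y : pt) (v : seq pt).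

Lemma seg_lerp a b : seg a b = (fun u : R => lerp a b u : pt) @` `[0, 1].
Proof.
apply/seteqP; split => [_ [l [l01 ->]]|_ [l l01 <-]].
  by exists l => //=; rewrite in_itv.
by exists l; split => //; move: l01; rewrite /= in_itv.
Qed.

Lemma seg_sym a b : seg a b `<=` seg b a.
Proof.
by move=> _ [l [l01 ->]]; exists (1 - l); split; [lra|rewrite -[LHS](lerp_rev b a)].
Qed.

Lemma seg_connected a b : connected (seg a b).
Proof.
rewrite seg_lerp; apply: connected_continuous_connected (@segment_connected R 0 1) _.
exact/continuous_subspaceT/lerp_continuous.
Qed.

Lemma seg_closed a b : closed (seg a b).
Proof.
rewrite seg_lerp; apply: compact_closed; first exact: norm_hausdorff.
apply: continuous_compact (@segment_compact R 0 1).
exact/continuous_subspaceT/lerp_continuous.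
Qed.

Lemma pboundary_closed v : closed (pboundary v).
Proof.
suff -> : pboundary v = \bigcup_(i in `I_(size v)) pedge v i.
  by apply: closed_bigcup => [|i _]; [exact: finite_II|exact: seg_closed].
by apply/seteqP; split => x [i]; [case=> h ?|move=> h ?]; exists i.
Qed.

Lemma pboundary_region v : pboundary v `<=` pregion v.
Proof. by move=> x bx [A [Ax [/(_ x Ax) nb _]]]; apply: nb. Qed.

(** If [z] were outside, the segment added to its unbounded connected set would show that [x] is
    outside too. *)
Lemma pregion_seg v x z : pregion v x -> seg x z `<=` ~` pboundary v -> pregion v z.
Proof.
move=> Px sxz [A [Az [Anb [cA uA]]]]; apply: Px.
have x_in : seg x z x by exists 0; split; [rewrite lexx ler01|exact: esym (lerp0 x z)].
have z_in : seg x z z by exists 1; split; [rewrite lexx ler01|exact: esym (lerp1 x z)].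
exists (A `|` seg x z); split; first by right.
split; first by move=> y [/Anb|/sxz].
split; first by apply: connectedU => //; [exists z|exact: seg_connected].
by move=> [M HM]; apply: uA; exists M => y Ay; apply: HM; left.
Qed.

Definition shift x (t : R) : pt := (x.1 + t, x.2).

Lemma shift_continuous x : continuous (shift x).
Proof.
have add : continuous (fun t : R => (x.1 : R) + t).
  by move=> t; apply: cvgD; [exact: cvg_cst|exact: cvg_id].
move=> t; apply: cvg_pair (add t) (cvg_cst _).
Qed.

(* A horizontal ray from an interior point must leave the region; follow it up
   to its first boundary point. *)
Lemma pregion_to_boundary v x : pregion v x ->
  exists2 y, pboundary v y & seg x y `<=` pregion v.
Proof.
move=> Px; pose T := [set t | 0 <= t /\ pboundary v (shift x t)].
have clT : closed (shift x @^-1` pboundary v).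
  have /continuous_closedP := @shift_continuous x; apply; exact: pboundary_closed.
have [[t1 Tt1]|T0] := pselect (exists t, T t); last first.
  (* A ray that misses the boundary is itself an unbounded connected set witnessing that [x] is
     outside. *)
  exfalso; apply: Px; exists (shift x @` [set t | 0 <= t]); split.
    by exists 0 => //=; rewrite /shift addr0 -surjective_pairing.
  split; first by move=> _ [t t0 <-] bt; apply: T0; exists t.
  split.
    apply: connected_continuous_connected; last first.
      exact/continuous_subspaceT/shift_continuous.
    by apply/connected_intervalP => s t /= s0 _ z /andP[sz _]; apply: le_trans sz.
  move=> [M HM]; have M0 : 0 <= `|M| + `|x.1 : R| + 1 by rewrite !addr_ge0.
  have [] := HM (shift x (`|M| + `|x.1 : R| + 1)); first by eexists; [exact: M0|].
  rewrite /shift /= => + _; rewrite ler_norml => /andP[_].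
  by have := ler_norm M; have := ler_norm (- (x.1 : R)); rewrite normrN; lra.
have hT : has_inf T by split; [exists t1|exists 0 => t []].
pose t0 := inf T.
have t00 : 0 <= t0 by apply: lb_le_inf; [case: hT|move=> t []].
have lt0 t : 0 <= t -> t < t0 -> ~ pboundary v (shift x t).
  move=> t0' tt bt; have : t0 <= t by apply: inf_lbound => //; exists 0 => s [].
  by rewrite leNgt tt.
have bt0 : pboundary v (shift x t0).
  (* The complement of the boundary is open, so a miss at [t0] would persist nearby and contradict
     the infimum. *)
  apply: contrapT => nb.
  have : open (~` (shift x @^-1` pboundary v)) by rewrite openC.
  rewrite openE => /(_ t0 nb) /nbhs_ballP[d /= d0 Hd].
  have [t [t0' bt] tlt] := inf_adherent d0 hT.
  apply: (Hd t) => //; rewrite /ball /= ltr_distlC.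
  have : t0 <= t by apply: inf_lbound => //; exists 0 => s [].
  by move: tlt; rewrite -/t0; lra.
exists (shift x t0) => // z [l [l01 Ez]].
have {Ez} Ez : z = shift x (l * t0).
  by rewrite Ez /shift /=; congr pair; ring.
have [lt|ge] := ltP (l * t0) t0; last first.
  have El : l * t0 = t0.
    by apply/eqP; rewrite eq_le ge andbT ler_piMl //; case/andP: l01.
  by apply: pboundary_region; rewrite Ez El.
apply: pregion_seg Px _; rewrite Ez => w [m [m01 ->]].
rewrite (_ : (_, _) = shift x (m * (l * t0))); last first.
  by rewrite /shift /=; congr pair; ring.
have lt00 : 0 <= l * t0 by rewrite mulr_ge0 //; case/andP: l01.
have /andP[m0 m1] := m01.
by apply: lt0; [rewrite mulr_ge0|apply: le_lt_trans lt; rewrite ler_piMl].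
Qed.

(** Each point is joined straight to the boundary, then along an edge to a vertex, then along edges
    to vertex 0. *)
Lemma pregion_rconn v x y : (0 < size v)%N -> pregion v x -> pregion v y ->
  rconn (pregion v) x y.
Proof.
move=> v0 Px Py.
have edge i : pedge v i `<=` pregion v.
  apply: subset_trans (@pboundary_region v) => z ez.
  exists (i %% size v)%N; split; first by rewrite ltn_pmod.
  suff E : pedge v (i %% size v)%N = pedge v i by rewrite E.
  by rewrite /pedge /vtx modn_mod -addn1 modnDml addn1.
(* Both directions are carried along, which avoids reversing paths. *)
have step i : rconn (pregion v) (vtx v i) (vtx v i.+1) /\
              rconn (pregion v) (vtx v i.+1) (vtx v i).
  split; first exact/rconn_seg/edge.
  by apply/rconn_seg => z /seg_sym; apply: edge.
have vv i : rconn (pregion v) (vtx v 0) (vtx v i) /\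
            rconn (pregion v) (vtx v i) (vtx v 0).
  elim: i => [|i [IH1 IH2]].
    suff rr : rconn (pregion v) (vtx v 0) (vtx v 0) by [].
    by case: (step 0%N) => h1 h2; apply: rconn_trans h1 h2.
  by case: (step i) => h1 h2; split; [apply: rconn_trans h1|apply: rconn_trans h2 _].
have to_edge z i : pedge v i z -> seg (vtx v i) z `<=` pregion v.
  move=> [l [l01 Ez]] w [m [m01 Ew]]; apply: (edge i); exists (m * l).
  case/andP: l01 m01 => l0 l1 /andP[m0 m1]; split.
    by rewrite mulr_ge0 //= mulr_ile1.
  by rewrite Ew Ez /=; congr pair; ring.
have out z : pregion v z -> rconn (pregion v) z (vtx v 0) /\
                            rconn (pregion v) (vtx v 0) z.
  move=> /pregion_to_boundary [w [i [_ iw]] sw]; have [h1 h2] := vv i.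
  split.
    apply: rconn_trans (rconn_seg sw) _; apply: rconn_trans h2.
    by apply: rconn_seg => u /seg_sym; apply: to_edge.
  apply: rconn_trans h1 _; apply: rconn_trans (rconn_seg (to_edge _ _ iw)) _.
  by apply: rconn_seg => u /seg_sym; apply: sw.
by case: (out x Px) (out y Py) => h1 _ [_ h2]; apply: rconn_trans h1 h2.
Qed.

End Region.

(** * Drawings of K33 through the centres of the disks *)

Section Discretization.
Variable R : realType.
Local Notation pt := (plpt R).

Lemma dist_lerp_lt (c y z e l : R) :
  0 <= l <= 1 -> `|c - y| < e -> `|c - z| < e ->
  `|c - ((1 - l) * y + l * z)| < e.
Proof.
move=> /andP[l0 l1] hy hz.
have -> : c - ((1 - l) * y + l * z) = (1 - l) * (c - y) + l * (c - z) by ring.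
apply: le_lt_trans (ler_normD _ _) _; rewrite !normrM.
rewrite (ger0_norm l0) ger0_norm ?subr_ge0 //.
set A := `|c - y| in hy *; set B := `|c - z| in hz *; pose m := Num.max A B.
have Am : A <= m by rewrite le_max lexx.
have Bm : B <= m by rewrite le_max lexx orbT.
have me : m < e by rewrite gt_max hy.
have := ler_wpM2l l0 Bm; have := ler_wpM2l (_ : 0 <= 1 - l) Am.
by rewrite subr_ge0 => /(_ l1); lra.
Qed.

(** Balls of the product are open squares of half-side [x]: they are convex, and disjoint when the
    centres differ by [2 * x] in a coordinate. *)
Lemma not_meets_ball (p q a b d e : pt) (x : R) :
  ball p x a -> ball p x b -> ball q x d -> ball q x e ->
  2 * x <= `|p.1 - q.1 : R| \/ 2 * x <= `|p.2 - q.2 : R| -> ~ meets a b d e.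
Proof.
move=> [a1 a2] [b1 b2] [d1 d2] [e1 e2] H [l [m [hl hm E]]].
have E1 := congr1 fst E; have E2 := congr1 snd E; rewrite /= in E1 E2.
have A1 := dist_lerp_lt hl a1 b1; have A2 := dist_lerp_lt hl a2 b2.
have B1 := dist_lerp_lt hm d1 e1; have B2 := dist_lerp_lt hm d2 e2.
case: H; apply/negP; rewrite -ltNge.
  apply: le_lt_trans (ler_distD ((1 - l) * a.1 + l * b.1) _ _) _.
  by rewrite [X in _ + X]distrC {2}E1; move: A1 B1; lra.
apply: le_lt_trans (ler_distD ((1 - l) * a.2 + l * b.2) _ _) _.
by rewrite [X in _ + X]distrC {2}E2; move: A2 B2; lra.
Qed.

(** Near each pair of times, short chords of [g] and [h] stay in disjoint squares; compactness of
    the square of times makes the fineness uniform. *)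
Lemma disjoint_paths_fine_chains (g h : R -> pt) :
  {within `[0, 1], continuous g} -> {within `[0, 1], continuous h} ->
  (forall s t : R, 0 <= s <= 1 -> 0 <= t <= 1 -> g s <> h t) ->
  \forall N \near \oo, forall s s' t t' : R,
    0 <= s <= 1 -> 0 <= s' <= 1 -> 0 <= t <= 1 -> 0 <= t' <= 1 ->
    `|s - s'| <= N.+1%:R^-1 -> `|t - t'| <= N.+1%:R^-1 ->
    ~ meets (g s) (g s') (h t) (h t').
Proof.
move=> /within01_continuousP cg /within01_continuousP ch dj.
pose Q (N : nat) (x : R * R) := forall s' t' : R, 0 <= s' <= 1 -> 0 <= t' <= 1 ->
  `|x.1 - s'| <= N.+1%:R^-1 -> `|x.2 - t'| <= N.+1%:R^-1 ->
  ~ meets (g x.1) (g s') (h x.2) (h t').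
have K : compact (`[0, 1]%classic `*` `[0, 1]%classic : set (R * R)).
  by apply: compact_setX; apply: segment_compact.
move/compact_near_coveringP/near_covering_withinP: K => /(_ nat \oo Q) K.
have {K} : \forall N \near \oo, `[0, 1]%classic `*` `[0, 1]%classic `<=` Q N.
  apply: K => -[s0 t0] [] /=; rewrite !in_itv /= => s01 t01.
  have [x x0 Hx] : exists2 x : R, 0 < x &
      2 * x <= `|(g s0).1 - (h t0).1 : R| \/ 2 * x <= `|(g s0).2 - (h t0).2 : R|.
    have [E1|n1] := eqVneq ((g s0).1 : R) (h t0).1.
      have [E2|n2] := eqVneq ((g s0).2 : R) (h t0).2.
        case: (dj s0 t0 s01 t01).
        by rewrite [LHS]surjective_pairing [RHS]surjective_pairing E1 E2.
      exists (`|(g s0).2 - (h t0).2 : R| / 2); last by right; lra.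
      by rewrite divr_gt0 // normr_gt0 subr_eq0.
    exists (`|(g s0).1 - (h t0).1 : R| / 2); last by left; lra.
    by rewrite divr_gt0 // normr_gt0 subr_eq0.
  have [d1 d10 H1] := cg s0 s01 x x0.
  have [d2 d20 H2] := ch t0 t01 x x0.
  (* Halved to allow for two moves: from the centre to the current time, and from there to the next
     one. *)
  pose d := Num.min d1 d2 / 2.
  have d0 : 0 < d by rewrite divr_gt0 // lt_min d10.
  have dd1 : 2 * d <= d1 by rewrite mulrC divfK // ge_min lexx.
  have dd2 : 2 * d <= d2 by rewrite mulrC divfK // ge_min lexx orbT.
  exists (ball s0 d `*` ball t0 d, [set N | N.+1%:R^-1 < d]).
    split => /=; last exact: (near_infty_natSinv_lt (PosNum d0)).
    by exists (ball s0 d, ball t0 d) => //=; split; apply: nbhsx_ballx.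
  move=> [[s t] N] [[/= bs bt] hN] [] /=; rewrite !in_itv /= => s1 t1.
  move=> s' t' s'1 t'1 ss tt.
  rewrite /ball /= in bs bt hN ss tt.
  have twod (a b c e : R) : `|a - b| < d -> `|b - c| <= N.+1%:R^-1 ->
      2 * d <= e -> `|a - c| < e.
    move=> ab bc; apply: lt_le_trans; apply: le_lt_trans (ler_distD b _ _) _.
    by rewrite mulr2n mulrDl !mul1r ltr_leD // (le_trans bc) // ltW.
  have one (a b e : R) : `|a - b| < d -> 2 * d <= e -> `|a - b| < e.
    by move=> ab; apply: twod ab _; rewrite subrr normr0 invr_ge0.
  apply: (@not_meets_ball (g s0) (h t0) _ _ _ _ x) => //.
  - by apply: H1 => //; apply: one bs dd1.
  - by apply: H1 => //; apply: twod bs ss dd1.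
  - by apply: H2 => //; apply: one bt dd2.
  - by apply: H2 => //; apply: twod bt tt dd2.
apply: filterS => N HN s s' t t' s01 s'01 t01 t'01 ss tt.
by apply: (HN (s, t)) => //; split; rewrite /= in_itv.
Qed.

End Discretization.

(** * Incidences forced by the non-planarity of K33 *)

Section K33.
Variable R : realType.
Local Notation pt := (plpt R).

Lemma finite_gap (n : nat) (f : nat -> R) : (forall k, (k < n)%N -> 0 < f k) ->
  exists2 e, 0 < e & forall k, (k < n)%N -> e < f k.
Proof.
elim: n => [|n IH] H; first by exists 1.
have [e e0 He] := IH (fun k h => H k (ltnW h)).
have fn := H n (ltnSn n).
exists (Num.min e (f n / 2)); first by rewrite lt_min e0 divr_gt0.
move=> k; rewrite ltnS leq_eqVlt => /orP[/eqP ->|/He h].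
  by rewrite gt_min; apply/orP; right; lra.
by rewrite gt_min h.
Qed.

(* The reverse of [g] followed by [h], sampled at times [s = 0, ..., 2 * M]. *)
Definition sample (g h : R -> pt) M s : pt :=
  if (s <= M)%N then g ((M - s)%:R / M%:R) else h ((s - M)%:R / M%:R).

(** The sample at [s = M] is the common start of [g] and [h], so it belongs to either path and no
    step straddles both. *)
Lemma sample_step (g h : R -> pt) M s : (0 < M)%N -> (s < M + M)%N -> g 0 = h 0 ->
  exists (left : bool) (t t' : R),
  [/\ 0 <= t <= 1, 0 <= t' <= 1, `|t - t'| <= M%:R^-1,
      sample g h M s = (if left then g else h) t &
      sample g h M s.+1 = (if left then g else h) t'].
Proof.
move=> M0 sM E.
have M0' : 0 < M%:R :> R by rewrite ltr0n.
have mem k : (k <= M)%N -> 0 <= (k%:R / M%:R : R) <= 1.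
  by move=> kM; rewrite ler_pdivlMr // ler_pdivrMr // mul0r mul1r ler0n ler_nat.
have step k : `|k.+1%:R / M%:R - k%:R / M%:R : R| <= M%:R^-1.
  by rewrite -mulrBl -natrB // subSnn mul1r ger0_norm // invr_ge0 ltW.
rewrite /sample; have [h1|h1] := ltnP s M.
  exists true, ((M - s)%:R / M%:R), ((M - s.+1)%:R / M%:R); rewrite ltnW //; split => //.
  - by apply: mem; lia.
  - by apply: mem; lia.
  - by rewrite -(subnSK h1).
exists false, ((s - M)%:R / M%:R), ((s.+1 - M)%:R / M%:R); split => //.
- by apply: mem; lia.
- by apply: mem; lia.
- by rewrite distrC subSn.
- case: ltngtP h1 => // -> _; by rewrite subnn mul0r.
Qed.

(* Draw the edge [r i -- b j] through the centre [c i j] by near-geodesics.  If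
   the edges [r i -- b j] and [r k -- b l] crossed, exchanging their tails would
   put an endpoint of one in the disk of the other. *)
Lemma K33_disks (P : set pt) (r b : nat -> pt) (c : nat -> nat -> pt) :
  (forall i j, rconn P (c i j) (r i)) -> (forall i j, rconn P (c i j) (b j)) ->
  (forall i j, gdist P (c i j) (r i) = gdist P (c i j) (b j)) ->
  uniq [:: b 0%N; b 1%N; b 2%N] ->
  exists i j k, [/\ (i < 3)%N, (j < 3)%N, (k < 3)%N &
  (k != i) && (gdist P (c i j) (r k) <= gdist P (c i j) (r i)) ||
  (k != j) && (gdist P (c i j) (b k) <= gdist P (c i j) (r i))].
Proof.
move=> conn_r conn_b equi b_uniq; apply: contrapT => H.
pose rho i j := gdist P (c i j) (r i).
(* The slack [e] is below every gap between the radius and the distance to another of the six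
   points; there are finitely many. *)
have /choice[e He] : forall ij : nat * nat, exists e, 0 < e /\
    ((ij.1 < 3)%N -> (ij.2 < 3)%N -> forall k, (k < 3)%N ->
    (k != ij.1 -> rho ij.1 ij.2 + e < gdist P (c ij.1 ij.2) (r k)) /\
    (k != ij.2 -> rho ij.1 ij.2 + e < gdist P (c ij.1 ij.2) (b k))).
  move=> [i j] /=; case: (boolP ((i < 3)%N && (j < 3)%N)) => [/andP[hi hj]|h].
    (* The value 1 is a dummy positive gap for the edge's own endpoint. *)
    have [|e1 e10 He1] := @finite_gap 3
        (fun k => if k == i then 1 else gdist P (c i j) (r k) - rho i j).
      move=> k hk; case: eqVneq => // ki; rewrite subr_gt0 ltNge.
      by apply/negP => le; apply: H; exists i, j, k; rewrite ki le.
    have [|e2 e20 He2] := @finite_gap 3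
        (fun k => if k == j then 1 else gdist P (c i j) (b k) - rho i j).
      move=> k hk; case: eqVneq => // kj; rewrite subr_gt0 ltNge.
      by apply/negP => le; apply: H; exists i, j, k; rewrite kj le orbT.
    exists (Num.min e1 e2); split; first by rewrite lt_min e10.
    move=> _ _ k hk; split => [/negbTE kn|/negbTE kn].
      have := He1 k hk; rewrite kn ltrBrDl; apply: le_lt_trans.
      by rewrite lerD2l ge_min lexx.
    have := He2 k hk; rewrite kn ltrBrDl; apply: le_lt_trans.
    by rewrite lerD2l ge_min lexx orbT.
  by exists 1; split => // hi hj; rewrite hi hj in h.
pose tip (left : bool) i j := if left then r i else b j.
have /choice[g Hg] : forall x : bool * nat * nat, exists g,
    ppath P g (c x.1.2 x.2) (tip x.1.1 x.1.2 x.2) /\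
    length_le g 0 1 (rho x.1.2 x.2 + e (x.1.2, x.2)).
  move=> [[[] i] j] /=; have [e0 _] := He (i, j).
    by have [g] := near_geodesic e0 (conn_r i j); exists g.
  by have [g] := near_geodesic e0 (conn_b i j); rewrite -equi; exists g.
(* A common point would bound two exchanged distances by the sum of the two path lengths, yet each
   exceeds radius plus slack. *)
have disj (x y : bool) i j k l :
    (i < 3)%N -> (j < 3)%N -> (k < 3)%N -> (l < 3)%N -> i != k -> j != l ->
    forall s t : R, 0 <= s <= 1 -> 0 <= t <= 1 -> g (x, i, j) s <> g (y, k, l) t.
  move=> hi hj hk hl ik jl s t s01 t01 E.
  have [p1 l1] := Hg (x, i, j); have [p2 l2] := Hg (y, k, l).
  have /= := gdist_exchange s01 t01 p1 p2 l1 l2 E.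
  have far (z : bool) i' j' k' l' : (i' < 3)%N -> (j' < 3)%N ->
      (k' < 3)%N -> (l' < 3)%N -> i' != k' -> j' != l' ->
      rho i' j' + e (i', j') < gdist P (c i' j') (tip z k' l').
    move=> h1 h2 h3 h4 h5 h6; have [_ /= /(_ h1 h2) far] := He (i', j').
    case: z => /=; [case: (far k' h3) => + _|case: (far l' h4) => _]; apply;
    by rewrite eq_sym.
  have f1 := far y i j k l hi hj hk hl ik jl.
  have f2 := far x k l i j hk hl hi hj.
  rewrite eq_sym in ik; rewrite eq_sym in jl; have {}f2 := f2 ik jl.
  by apply/negP; rewrite -ltNge; apply: ltrD.
(* One [N] serves all of the finitely many pairs of half-edges. *)
have fine : \forall N \near \oo,
    forall z : bool * bool * ('I_3 * 'I_3) * ('I_3 * 'I_3),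
    let: (x, y, (i, j), (k, l)) := z in
    let p := g (x, nat_of_ord i, nat_of_ord j) in
    let q := g (y, nat_of_ord k, nat_of_ord l) in
    i != k -> j != l -> forall s s' t t' : R,
    0 <= s <= 1 -> 0 <= s' <= 1 -> 0 <= t <= 1 -> 0 <= t' <= 1 ->
    `|s - s'| <= N.+1%:R^-1 -> `|t - t'| <= N.+1%:R^-1 ->
    ~ meets (p s) (p s') (q t) (q t').
  apply: filter_forall => -[[[x y] [i j]] [k l]] /=.
  have [ik|ik] := eqVneq i k; first by near=> N.
  have [jl|jl] := eqVneq j l; first by near=> N.
  have [[c1 _] _] := Hg (x, nat_of_ord i, nat_of_ord j).
  have [[c2 _] _] := Hg (y, nat_of_ord k, nat_of_ord l).
  have ijkl := disj x y i j k l (ltn_ord _) (ltn_ord _) (ltn_ord _) (ltn_ord _).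
  have := disjoint_paths_fine_chains c1 c2 (ijkl ik jl).
  by apply: filterS => N HN _ _.
have [N HN] := filter_ex fine.
pose ch i j s := sample (g (true, i, j)) (g (false, i, j)) N.+1 s.
have sz : (0 < N.+1 + N.+1)%N by [].
have N0 : N.+1%:R != 0 :> R by rewrite pnatr_eq0.
have ch0 i j : ch i j 0 = r i.
  rewrite /ch /sample subn0 divff //.
  by have [[_ [_ [-> _]]] _] := Hg (true, i, j).
have chN i j : ch i j (N.+1 + N.+1)%N = b j.
  rewrite /ch /sample addnK divff // leqNgt -addn1 leq_add2l //=.
  by have [[_ [_ [-> _]]] _] := Hg (false, i, j).
move: b_uniq; rewrite /= !inE negb_or andbT => /andP[/andP[b01 b02] b12].
apply: (K33_chains_meet sz ch0 chN b01 b02 b12).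
move=> i j k l hi hj hk hl ik jl s t hs ht.
have start i' j' : g (true, i', j') 0 = g (false, i', j') 0.
  have [[_ [-> _]] _] := Hg (true, i', j').
  by have [[_ [-> _]] _] := Hg (false, i', j').
have [x [s1 [s2 [m1 m2 d1 E1 E2]]]] := sample_step (ltn0Sn N) hs (start i j).
have [y [t1 [t2 [m3 m4 d2 E3 E4]]]] := sample_step (ltn0Sn N) ht (start k l).
rewrite /ch E1 E2 E3 E4.
have fE (z : bool) i' j' :
    (if z then g (true, i', j') else g (false, i', j')) = g (z, i', j').
  by case: z.
rewrite !fE.
exact: (HN ((x, y), (Ordinal hi, Ordinal hj), (Ordinal hk, Ordinal hl))).
Unshelve. all: by end_near. Qed.

End K33.

(** * Averaging over samples *)

Section Sampling.
Local Open Scope nat_scope.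
Variable m : nat.

(** A transposition takes [a] to [a']; a second one takes the image of [c] to [c'] and fixes
    [a']. *)
Lemma perm_of_pairs (T : finType) (a c a' c' : T) : a != c -> a' != c' ->
  exists s : {perm T}, s a = a' /\ s c = c'.
Proof.
move=> ac ac'; exists (tperm a a' * tperm (tperm a a' c) c')%g.
have ne : tperm a a' c != a'.
  by rewrite -[X in _ != X](tpermL a a') (inj_eq perm_inj) eq_sym.
by rewrite !permM !tpermL; split => //; rewrite tpermD // eq_sym.
Qed.

(** The sum is the same for every [b], so it is summed over all [b] and the sums are swapped.
    Denominators are cleared to stay in [nat]. *)
Lemma sum_perm1 (G : 'I_m -> nat) (b : 'I_m) :
  (\sum_(s : 'S_m) G (s b)) * m = m`! * \sum_j G j.
Proof.
have indep b' : \sum_(s : 'S_m) G (s b') = \sum_(s : 'S_m) G (s b).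
  rewrite (reindex_inj (mulgI (tperm b b'))) /=.
  by apply: eq_bigr => s _; rewrite permM tpermR.
rewrite mulnC -{1}(card_ord m) -sum_nat_const.
under eq_bigr => b' _ do rewrite -(indep b').
rewrite exchange_big /= -card_Sn -cardsT -sum_nat_const.
by apply: eq_big => [s|s _]; rewrite ?inE // [RHS](reindex_inj (@perm_inj _ s)).
Qed.

(** The same averaging over ordered pairs, by double transitivity of the symmetric group. *)
Lemma sum_perm2 (F : 'I_m -> 'I_m -> nat) (a c : 'I_m) : a != c ->
  (\sum_(s : 'S_m) F (s a) (s c)) * (m * m.-1) =
  m`! * \sum_i \sum_(j | j != i) F i j.
Proof.
move=> ac.
have indep a' c' : c' != a' ->
    \sum_(s : 'S_m) F (s a') (s c') = \sum_(s : 'S_m) F (s a) (s c).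
  rewrite eq_sym => ac'; have [u [ua uc]] := perm_of_pairs ac ac'.
  rewrite [RHS](reindex_inj (mulgI u)) /=.
  by apply: eq_bigr => s _; rewrite !permM ua uc.
have -> : (\sum_(s : 'S_m) F (s a) (s c)) * (m * m.-1) =
    \sum_(a' < m) \sum_(c' | c' != a') \sum_(s : 'S_m) F (s a') (s c').
  set S0 := \sum_s _.
  transitivity (\sum_(a' < m) \sum_(c' < m | c' != a') S0); last first.
    by apply: eq_bigr => a' _; apply: eq_bigr => c' /indep.
  rewrite (eq_bigr (fun=> m.-1 * S0)) => [|a' _].
    by rewrite sum_nat_const card_ord; lia.
  by rewrite sum_nat_const; have := cardC1 a'; rewrite card_ord => ->.
transitivity (\sum_(s : 'S_m) \sum_i \sum_(j | j != i) F (s i) (s j)).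
  by rewrite [RHS]exchange_big; apply: eq_bigr => i _; rewrite exchange_big.
rewrite -card_Sn -cardsT -sum_nat_const.
apply: eq_big => [s|s _]; rewrite ?inE // [RHS](reindex_inj (@perm_inj _ s)) /=.
apply: eq_bigr => i _; rewrite [RHS](reindex_inj (@perm_inj _ s)) /=.
by apply: eq_bigl => j; rewrite (inj_eq perm_inj).
Qed.

Lemma sum_perm21 (F : 'I_m -> 'I_m -> 'I_m -> nat) (a c b : 'I_m) : a != c ->
  (\sum_(s : 'S_m) \sum_(t : 'S_m) F (s a) (s c) (t b)) * (m * m.-1 * m) =
  m`! * m`! * \sum_i \sum_(j | j != i) \sum_k F i j k.
Proof.
move=> ac; rewrite mulnA -mulnA [_ * m]mulnC mulnA big_distrl /=.
under eq_bigr => s _ do rewrite (sum_perm1 (F (s a) (s c))).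
rewrite -big_distrr /= -!mulnA (sum_perm2 (fun i j => \sum_k F i j k) ac).
by [].
Qed.

(* The averaging step: in a random sample of three reds and three blues, the
   expected number of incidences of a sampled point with the disk of a sampled
   edge is at most [18 * k / (m - 1)]. *)
Lemma empty_sample (k : nat) (Dr Db : 'I_m -> 'I_m -> pred 'I_m) :
  3 <= m -> 18 * k < m.-1 ->
  (forall i j, #|[pred x | (x != i) && Dr i j x]| +
               #|[pred y | (y != j) && Db i j y]| <= k) ->
  exists f g : 'I_3 -> 'I_m, [/\ injective f, injective g &
    forall a b c, (c != a -> ~~ Dr (f a) (g b) (f c)) /\
                  (c != b -> ~~ Db (f a) (g b) (g c))].
Proof.
move=> m3 km few; pose w := widen_ord m3.
have w_inj : injective w by move=> x y /(congr1 val) /= /val_inj.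
pose hits (s t : 'S_m) := \sum_(a < 3) \sum_(b < 3)
  (\sum_(c < 3 | c != a) (Dr (s (w a)) (t (w b)) (s (w c)) : nat) +
   \sum_(c < 3 | c != b) (Db (s (w a)) (t (w b)) (t (w c)) : nat)).
case: (boolP [exists s, exists t, hits s t == 0]) => [/existsP[s /existsP[t]]|].
  rewrite /hits sum_nat_eq0 => /forallP H; exists (s \o w), (t \o w); split.
  - by apply: inj_comp w_inj; apply: perm_inj.
  - by apply: inj_comp w_inj; apply: perm_inj.
  move=> a b c; have := H a; rewrite /= sum_nat_eq0 => /forallP/(_ b) /=.
  rewrite addn_eq0 !sum_nat_eq0 => /andP[/forallP/(_ c) h1 /forallP/(_ c) h2].
  by split=> cn; [move: h1|move: h2]; rewrite cn /= eqb0.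
(* Otherwise every pair of permutations has an incidence; double counting refutes this. *)
rewrite negb_exists => /forallP hpos; exfalso.
pose S := \sum_(s : 'S_m) \sum_(t : 'S_m) hits s t.
have Sge : m`! * m`! <= S.
  have sum1 : \sum_(s : 'S_m) \sum_(t : 'S_m) 1 = m`! * m`!.
    by rewrite !sum_nat_const muln1 !card_Sn.
  rewrite -sum1; apply: leq_sum => s _; apply: leq_sum => t _.
  by have := hpos s; rewrite negb_exists => /forallP/(_ t); rewrite lt0n.
pose Kr := \sum_i \sum_(x | x != i) \sum_j (Dr i j x : nat).
pose Kb := \sum_j \sum_(y | y != j) \sum_i (Db i j y : nat).
(* The factor 18 is 9 edges times the 2 other sampled points of a given colour. *)
have SE : S * (m * m.-1 * m) = 18 * (m`! * m`!) * (Kr + Kb).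
  have -> : S = \sum_(a < 3) \sum_(b < 3)
     (\sum_(c < 3 | c != a) \sum_(s : 'S_m) \sum_(t : 'S_m)
        (Dr (s (w a)) (t (w b)) (s (w c)) : nat) +
      \sum_(c < 3 | c != b) \sum_(t : 'S_m) \sum_(s : 'S_m)
        (Db (s (w a)) (t (w b)) (t (w c)) : nat)).
    rewrite /S /hits; under eq_bigr => s _ do rewrite exchange_big.
    rewrite exchange_big; apply: eq_bigr => a _.
    under eq_bigr => s _ do rewrite exchange_big.
    rewrite exchange_big; apply: eq_bigr => b _.
    under eq_bigr => s _ do rewrite big_split.
    rewrite big_split; congr (_ + _).
      under eq_bigr => s _ do rewrite exchange_big.
      by rewrite exchange_big.
    under eq_bigr => s _ do rewrite exchange_big.
    by rewrite exchange_big; apply: eq_bigr => c _; rewrite exchange_big.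
  have two (a : 'I_3) X : \sum_(c < 3 | c != a) X = 2 * X.
    by rewrite sum_nat_const; have := cardC1 a; rewrite card_ord => ->.
  rewrite big_distrl /=.
  have nine X : \sum_(a < 3) \sum_(b < 3) X = 9 * X.
    by rewrite !sum_nat_const card_ord mulnA.
  transitivity (\sum_(a < 3) \sum_(b < 3)
      (2 * (m`! * m`! * Kr) + 2 * (m`! * m`! * Kb))); last first.
    by rewrite nine; lia.
  apply: eq_bigr => a _; rewrite big_distrl; apply: eq_bigr => b _ /=.
  rewrite mulnDl -(two a) -(two b) !big_distrl /=; congr (_ + _); apply: eq_bigr => c cn.
    by rewrite (sum_perm21 (fun i x j => Dr i j x)) // (inj_eq w_inj) eq_sym.
  by rewrite (sum_perm21 (fun j y i => Db i j y)) // (inj_eq w_inj) eq_sym.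
have Kle : Kr + Kb <= m * m * k.
  have -> : Kr = \sum_i \sum_j #|[pred x | (x != i) && Dr i j x]|.
    apply: eq_bigr => i _; rewrite exchange_big; apply: eq_bigr => j _.
    by rewrite -big_mkcondr -sum1_card.
  have -> : Kb = \sum_i \sum_j #|[pred y | (y != j) && Db i j y]|.
    rewrite [RHS]exchange_big /=; apply: eq_bigr => j _.
    rewrite exchange_big; apply: eq_bigr => i _.
    by rewrite -big_mkcondr -sum1_card.
  rewrite -big_split /=.
  apply: (@leq_trans (\sum_(i < m) \sum_(j < m) k)).
    by apply: leq_sum => i _; rewrite -big_split; apply: leq_sum => j _; apply: few.
  by rewrite !sum_nat_const card_ord mulnA.
have : m`! * m`! * (m * m.-1 * m) <= 18 * (m`! * m`!) * (m * m * k).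
  apply: leq_trans (leq_mul Sge (leqnn _)) _; rewrite SE.
  by rewrite leq_mul.
apply/negP; rewrite -ltnNge.
have -> : 18 * (m`! * m`!) * (m * m * k) = m`! * m`! * (m * m) * (18 * k) by lia.
have -> : m`! * m`! * (m * m.-1 * m) = m`! * m`! * (m * m) * m.-1 by lia.
by rewrite ltn_pmul2l // !muln_gt0 !fact_gt0 (leq_trans _ m3).
Qed.
End Sampling.

(** * Combining the drawing with the averaging bound *)

Lemma count_nth_card (T : eqType) (x0 : T) (p : pred T) (s : seq T) m :
  size s = m -> count p s = #|[pred i : 'I_m | p (nth x0 s i)]|.
Proof.
move=> sm; rewrite -sum1_count (big_nth x0) sm big_mkord -sum1_card.
by apply: eq_bigl => i; rewrite inE.
Qed.

Theorem theorem9 (R : realType) (n : nat) (v : seq (plpt R)) (red blue : seq (plpt R)) :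
  (6 <= n)%N -> ~~ odd n ->
  simple_polygon v ->
  size red = n./2 -> size blue = n./2 -> uniq (red ++ blue) ->
  (forall s, s \in red ++ blue -> pregion v s) ->
  general_position v (red ++ blue) ->
  exists r b, r \in red /\ b \in blue /\
    forall (c : plpt R) (rho : R), pregion v c ->
      gdist (pregion v) c r = rho -> gdist (pregion v) c b = rho ->
      ((n - 2 + 35) %/ 36 + 2 <=
         count (fun s => (gdist (pregion v) c s <= rho)%R) (red ++ blue))%N.
Proof.
move=> n6 nodd [v3 _] szr szb; rewrite cat_uniq => /and3P[_ _ ublue] inP _.
set P := pregion v in inP *; set m := n./2 in szr szb.
have nm : n = (m + m)%N by rewrite addnn -[LHS]odd_double_half (negbTE nodd).
set K := ((n - 2 + 35) %/ 36)%N.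
have K1 : (1 <= K)%N by rewrite /K; lia.
(* [K] is the ceiling of [(n - 2) / 36 = (m - 1) / 18], so [K - 1] is strictly smaller than this
   quotient. *)
have Km : (18 * K.-1 < m.-1)%N by rewrite /K; lia.
have m3 : (3 <= m)%N by lia.
pose r (i : 'I_m) : plpt R := nth (0, 0) red i.
pose b (j : 'I_m) : plpt R := nth (0, 0) blue j.
have r_in i : r i \in red by rewrite mem_nth // szr.
have b_in j : b j \in blue by rewrite mem_nth // szb.
apply: contrapT => H.
(* If the bound fails, every pair has a disk with fewer than [K + 2] points. *)
have /choice[c Hc] : forall ij : 'I_m * 'I_m, exists c, [/\ P c,
    gdist P c (r ij.1) = gdist P c (b ij.2) &
    (count (fun s => (gdist P c s <= gdist P c (r ij.1))%R) (red ++ blue) < K + 2)%N].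
  move=> [i j]; apply: contrapT => Hij; apply: H; exists (r i), (b j); split=> //.
  split=> // c rho Pc Er Eb; rewrite leqNgt; apply/negP => lt.
  by apply: Hij; exists c; rewrite Er Eb; split.
pose Dr i j (x : 'I_m) := gdist P (c (i, j)) (r x) <= gdist P (c (i, j)) (r i).
pose Db i j (y : 'I_m) := gdist P (c (i, j)) (b y) <= gdist P (c (i, j)) (r i).
(* [r i] and [b j] are themselves in the disk, which leaves at most [K - 1] others. *)
have few i j : (#|[pred x | (x != i) && Dr i j x]| +
                #|[pred y | (y != j) && Db i j y]| <= K.-1)%N.
  have [_ /= E] := Hc (i, j).
  rewrite count_cat (count_nth_card (0, 0) _ szr) (count_nth_card (0, 0) _ szb).
  have -> : #|[pred x : 'I_m | gdist P (c (i, j)) (nth (0, 0) red x) <=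
              gdist P (c (i, j)) (r i)]| = #|[pred x | (x != i) && Dr i j x]|.+1.
    by rewrite (cardD1 i) inE lexx add1n; congr S; apply: eq_card.
  have -> : #|[pred y : 'I_m | gdist P (c (i, j)) (nth (0, 0) blue y) <=
              gdist P (c (i, j)) (r i)]| = #|[pred y | (y != j) && Db i j y]|.+1.
    rewrite (cardD1 j) inE E lexx add1n; congr S.
    by apply: eq_card => y; rewrite !inE /Db E.
  by rewrite addSn addnS addn2 !ltnS => lt; rewrite -ltnS prednK.
have [f [g [f_inj g_inj empty]]] := empty_sample m3 Km few.
(* [inord] extends the indices to all naturals; only those below 3 matter. *)
pose f' (i : nat) := f (inord i); pose g' (j : nat) := g (inord j).
have conn i j s : s \in red ++ blue -> rconn P (c (i, j)) s.
  move=> /inP Ps; have [Pc _ _] := Hc (i, j).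
  by apply: pregion_rconn => //; apply: leq_trans v3.
have ord3_neq i j : (i < 3)%N -> (j < 3)%N -> i != j -> inord i != inord j :> 'I_3.
  by move=> hi hj; apply: contra_neq => /(congr1 val) /=; rewrite !inordK.
have b_neq i j : (i < 3)%N -> (j < 3)%N -> i != j -> b (g' i) != b (g' j).
  move=> hi hj ij; rewrite /b nth_uniq ?szb //.
  by apply: contra_neq (ord3_neq _ _ hi hj ij) => /val_inj/g_inj.
have [||||i [j [k [hi hj hk]]]] :=
  @K33_disks R P (r \o f') (b \o g') (fun i j => c (f' i, g' j)).
- by move=> i j; apply: conn; rewrite mem_cat r_in.
- by move=> i j; apply: conn; rewrite mem_cat b_in orbT.
- by move=> i j; have [_ ->] := Hc (f' i, g' j).
- by rewrite /= !inE !negb_or !b_neq.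
have [h1 h2] := empty (inord i) (inord j) (inord k).
case/orP => /andP[kn]; apply/negP; first by apply: h1; apply: ord3_neq.
by apply: h2; apply: ord3_neq.
Qed.
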